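(* Let $G=(V,A,E)$ be a mixed graph in which every pseudo dicut contains at least $\lambda$ edges from $E$, where $\lambda\geq3$. Then the number of $G$-strong orientations is at least $2^{(1-H(1/\lambda))|E|}$.
   Context: A mixed graph $G=(V,A,E)$ has a set $A$ of arcs (directed) and a set $E$ of edges (undirected). A $G$-strong orientation is an orientation $\overrightarrow{E}$ of the edges in $E$ such that the digraph $(V,A\cup\overrightarrow{E})$ is strongly connected. A pseudo dicut is a cut $\delta_G(U)\subseteq A\cup E$ (the arcs and edges with exactly one end in $U$), where $\emptyset\neq U\subsetneq V$ and no arc of $A$ enters $U$ (i.e. $\delta^-_A(U)=\emptyset$). $H$ is the binary entropy function $H(\varepsilon)=-\varepsilon\log_2\varepsilon-(1-\varepsilon)\log_2(1-\varepsilon)$ for $\varepsilon\in(0,\tfrac12]$. *)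

(* Defs.v *)
From mathcomp Require Import all_boot all_order all_algebra.
From mathcomp Require Import all_classical all_reals all_analysis.

Set Implicit Arguments.
Unset Strict Implicit.
Unset Printing Implicit Defensive.

Import Order.TTheory GRing.Theory Num.Theory.

(* Finite mixed multigraphs: arcs and edges are abstract items, so parallel
   ones are allowed. The order in which [edge_end1] and [edge_end2] list the
   ends of an edge is only a labelling, with respect to which orientations are
   encoded. *)
Record mixed_graph := MixedGraph {
  mg_vertex : finType;
  mg_arc : finType;
  mg_edge : finType;
  arc_tail : mg_arc -> mg_vertex;
  arc_head : mg_arc -> mg_vertex;
  edge_end1 : mg_edge -> mg_vertex;
  edge_end2 : mg_edge -> mg_vertex
}.

Section MixedGraph.
Variable G : mixed_graph.
Implicit Types (U : {set mg_vertex G}) (C : {set mg_arc G + mg_edge G}).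

(* [o e = true] directs [e] from [edge_end1 e] to [edge_end2 e], and
   [o e = false] the other way. A loop thus has two orientations. *)
Definition orientation := {ffun mg_edge G -> bool}.

Definition edge_tail (o : orientation) (e : mg_edge G) : mg_vertex G :=
  if o e then edge_end1 e else edge_end2 e.

Definition edge_head (o : orientation) (e : mg_edge G) : mg_vertex G :=
  if o e then edge_end2 e else edge_end1 e.

Definition oriented_adj (o : orientation) : rel (mg_vertex G) :=
  fun u v =>
    [exists a : mg_arc G, (arc_tail a == u) && (arc_head a == v)]
    || [exists e : mg_edge G, (edge_tail o e == u) && (edge_head o e == v)].

Definition strong_orientation (o : orientation) : bool :=
  [forall u, forall v, connect (oriented_adj o) u v].

Definition mg_cut U : {set mg_arc G + mg_edge G} :=
  [set x | match x with
           | inl a => (arc_tail a \in U) != (arc_head a \in U)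
           | inr e => (edge_end1 e \in U) != (edge_end2 e \in U)
           end].

Definition arcs_in U : {set mg_arc G} :=
  [set a | (arc_tail a \notin U) && (arc_head a \in U)].

Definition pseudo_dicut C : Prop :=
  exists U, [/\ U != finset.set0, U \proper [set: mg_vertex G]%SET,
                arcs_in U = finset.set0 & C = mg_cut U].

Definition cut_edges C : {set mg_edge G} := [set e | inr e \in C].

End MixedGraph.

Section Entropy.
Local Open Scope ring_scope.
Variable R : realType.

Definition log2 (x : R) : R := ln x / ln 2.

Definition binary_entropy (eps : R) : R :=
  - (eps * log2 eps) - (1 - eps) * log2 (1 - eps).

End Entropy.

(* Main.v *)
Require Import Defs.
From mathcomp Require Import all_boot all_order all_algebra.
From mathcomp Require Import all_classical all_reals all_analysis.
From mathcomp Require Import zify ring lra.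

(** Every orientation [o] of the edges can be made strong by reversing at most
    [|E| / lambda] of them. Indeed, the dicuts of the digraph [A + o(E)] are
    pseudo dicuts, hence contain at least [lambda] edges, so at most
    [|E| / lambda] of them have pairwise disjoint edge sets; by the
    Lucchesi-Younger theorem (in which the arcs of [A] cannot be used) some
    [J] of that size contained in [E] meets all dicuts, and reversing an
    inclusion-minimal such [J] makes the digraph strongly connected. The
    Hamming balls of radius [|E| / lambda] around the strong orientations thus
    cover all [2 ^ |E|] orientations, while each of them has at most
    [2 ^ (H(1 / lambda) |E|)] elements. *)

Set Implicit Arguments.
Unset Strict Implicit.
Unset Printing Implicit Defensive.

Import Order.TTheory GRing.Theory Num.Theory.

(** * Parity of ranks in a finite chain *)

Lemma card_chain_parity (I : finType) (C : {set I}) (lt : rel I) (b : bool) :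
    irreflexive lt -> transitive lt ->
    {in C &, forall i j, i != j -> lt i j || lt j i} ->
  #|[set i in C | odd #|[set j in C | lt j i]| == b]|
    = if b then #|C|./2 else uphalf #|C|.
Proof.
move=> ltxx lt_tr lt_tot; pose rk i := #|[set j in C | lt j i]|.
have rk_lt i j : i \in C -> lt i j -> rk i < rk j.
  move=> Ci lij; apply/proper_card/properP; split.
    apply/fintype.subsetP => k; rewrite !inE => /andP[-> lki].
    exact: lt_tr lki lij.
  by exists i; rewrite !inE ?Ci ?ltxx.
have rk_inj : {in C &, injective rk}.
  move=> i j Ci Cj eq_rk; apply/eqP/negPn/negP => /(lt_tot _ _ Ci Cj).
  by case/orP => /rk_lt; rewrite eq_rk ltnn; [move/(_ Ci)|move/(_ Cj)].
have uniq_rk : uniq (map rk (enum C)).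
  rewrite map_inj_in_uniq ?enum_uniq // => i j.
  by rewrite !mem_enum; apply: rk_inj.
(* Distinct ranks below [#|C|] must be exactly [0, ..., #|C| - 1]. Counting starts at the even rank
   0, so the even class gets the half rounded up. *)
have perm_rk : perm_eq (map rk (enum C)) (iota 0 #|C|).
  apply: uniq_perm; rewrite ?iota_uniq //.
  have [] // := @uniq_min_size _ (map rk (enum C)) (iota 0 #|C|) uniq_rk;
    last by rewrite size_map size_iota cardE.
  move=> _ /mapP[i Ci ->]; rewrite mem_enum in Ci.
  rewrite mem_iota /= add0n; apply/proper_card/properP; split.
    by apply/fintype.subsetP => k; rewrite !inE => /andP[].
  by exists i; rewrite // !inE ltxx andbF.
have -> : #|[set i in C | odd (rk i) == b]|
    = count (fun k => odd k == b) (iota 0 #|C|).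
  rewrite -(permP perm_rk) count_map -size_filter cardE /enum_mem.
  rewrite -filter_predI; congr size; apply: eq_filter => i /=.
  by rewrite !inE andbC.
elim: #|C| => [|n IHn]; first by case: b.
rewrite -addn1 iotaD count_cat IHn /= add0n addn0.
by case: b {IHn}; rewrite ?eqb_id; lia.
Qed.

(** * Packings and dijoins of a crossing family: the Lucchesi-Younger theorem *)

Section CrossingFamily.

Variables (V E : finType) (tl hd : E -> V) (F : pred {set V}).
Hypothesis F_no_enter : forall U e, F U -> hd e \in U -> tl e \in U.
Hypothesis F_crossing : forall U W, F U -> F W ->
  U :&: W != finset.set0 -> U :|: W != [set: V]%SET ->
  F (U :&: W) && F (U :|: W).

Definition leaves e (U : {set V}) := (tl e \in U) && (hd e \notin U).

(** Members are indexed so that a set may be repeated, as capacities above 1 permit. *)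
Definition packing (I : finType) (w : E -> nat) (f : I -> {set V}) :=
  [forall i, F (f i)] && [forall e, \sum_i leaves e (f i) <= w e].

Definition cross_free (I : finType) (f : I -> {set V}) :=
  forall i j, [|| f i \subset f j, f j \subset f i,
                  f i :&: f j == finset.set0 | f i :|: f j == [set: V]%SET].

(** Replacing two crossing members by their intersection and union respects the capacities and
    increases the sum of squared cardinalities; a packing maximizing that sum thus has no crossing
    pair. *)
Lemma uncross (I : finType) w (f : I -> {set V}) :
  packing w f -> exists2 g : I -> {set V}, packing w g & cross_free g.
Proof.
move=> pf; pose pot (g : {ffun I -> {set V}}) := \sum_i #|g i| ^ 2.
have pf0 : packing w [ffun i => f i].
  case/andP: pf => /forallP Ff /forallP cf; apply/andP; split.
    by apply/forallP => i; rewrite ffunE.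
  by apply/forallP => e; under eq_bigr do rewrite ffunE.
have [g pg maxg] := (@arg_maxnP {ffun I -> {set V}} [ffun i => f i]
  (fun g => packing w g) pot pf0).
exists g => // i j; apply/negPn/negP; rewrite !negb_or => /and4P[nij nji nI nU].
have ne_ij : j != i by apply: contraNneq nij => ->.
case/andP: (pg) => /forallP Fg /forallP cg.
have /andP[FI FU] := F_crossing (Fg i) (Fg j) nI nU.
pose h := [ffun k => if k == i then g i :&: g j
                     else if k == j then g i :|: g j else g k].
have sum_h (G : {set V} -> nat) :
    \sum_k G (h k) + G (g i) + G (g j)
      = \sum_k G (g k) + G (g i :&: g j) + G (g i :|: g j).
  rewrite (bigD1 i) //= (bigD1 j) //= [in RHS](bigD1 i) //=.
  rewrite [in RHS](bigD1 j) //= !ffunE eqxx (negPf ne_ij) eqxx.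
  rewrite (eq_bigr (fun k => G (g k))); first by rewrite -!addnA; do !nat_congr.
  by move=> k /andP[/negPf ki /negPf kj]; rewrite ffunE ki kj.
have ph : packing w h.
  apply/andP; split; [apply/forallP => k|apply/forallP => e].
    by rewrite ffunE; case: ifP => // _; case: ifP.
  have : leaves e (g i :&: g j) + leaves e (g i :|: g j)
      <= leaves e (g i) + leaves e (g j).
    rewrite /leaves !inE; case: (tl e \in g i); case: (tl e \in g j);
    by case: (hd e \in g i); case: (hd e \in g j).
  have := cg e; have := sum_h (leaves e : {set V} -> nat).
  move: (\sum_k _) (\sum_k _) (nat_of_bool _) (nat_of_bool _) (nat_of_bool _).
  by clear=> sh sg a b c; lia.
have := cardsUI (g i) (g j); have := sum_h (fun U => #|U| ^ 2).
have : \sum_k #|h k| ^ 2 <= \sum_k #|g k| ^ 2 by exact: maxg.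
have ltIi : #|g i :&: g j| < #|g i|.
  apply/proper_card/properP; split; first exact: finset.subsetIl.
  by case/subsetPn: nij => x xi xj; exists x; rewrite // inE xi.
have ltIj : #|g i :&: g j| < #|g j|.
  apply/proper_card/properP; split; first exact: finset.subsetIr.
  by case/subsetPn: nji => x xi xj; exists x; rewrite // inE xi andbT.
(* If the intersection has [a] elements and the two members have [a + c + 1] and [a + d + 1], the
   sum of squares grows by [2 (c + 1) (d + 1)], contradicting maximality. *)
rewrite -(subnKC ltIi) -(subnKC ltIj).
move: #|_ :&: _| #|_ :|: _| (_ - _) (_ - _) (\sum_k _) (\sum_k _).
clear=> a b c d sh sg le_s sum_s card_s; have b_def : b = a + c + d + 2 by lia.
by move: sum_s; rewrite b_def -!mulnn; lia.
Qed.

(* A cross-free family is represented by the edges of a tree rooted at the node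
   of [r]; every [e : E] leaving members of the family follows a directed path
   of that tree. Colouring a tree edge by the parity of the depth of its tail
   therefore alternates along each such path. *)
Lemma cross_free_balanced (I : finType) (w : E -> nat) (f : I -> {set V}) :
    packing (fun e => (w e).*2) f -> cross_free f ->
  exists2 S : {set I}, #|I| <= #|S|.*2
    & forall e, \sum_(i in S) leaves e (f i) <= w e.
Proof.
move=> /andP[/forallP Ff /forallP cf] xf.
case: (pickP (@predT V)) => [r _|V0]; last first.
  by exists [set: I]%SET => [|e]; [rewrite cardsT; lia | have := V0 (tl e)].
(* Complementing the members that contain [r] makes the family laminar: two sets [L i] are nested or
   disjoint. *)
pose L i := if r \in f i then ~: f i else f i.
have LE i x : (x \in L i) = (x \in f i) (+) (r \in f i).
  by rewrite /L; case: ifP; rewrite ?inE ?addbT ?addbF.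
have lam i j x : x \in L i -> x \in L j ->
    (L i \subset L j) || (L j \subset L i).
  have sub k l : (forall y, y \in L k -> y \in L l) -> L k \subset L l.
    by move=> H; apply/fintype.subsetP.
  move=> xi xj; case/or4P: (xf i j) =>
    [/fintype.subsetP s|/fintype.subsetP s|/eqP/setP s|/eqP/setP s].
  - have [rj|rj] := boolP (r \in f j); have [ri|ri] := boolP (r \in f i).
    + apply/orP; right; apply: sub => y; rewrite !LE ri rj !addbT.
      exact/contra/s.
    + by move: xi xj; rewrite !LE rj (negPf ri) addbT addbF => /s ->.
    + by rewrite (s _ ri) in rj.
    + apply/orP; left; apply: sub => y; rewrite !LE.
      by rewrite (negPf ri) (negPf rj) !addbF; apply: s.
  - have [rj|rj] := boolP (r \in f j); have [ri|ri] := boolP (r \in f i).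
    + apply/orP; left; apply: sub => y; rewrite !LE ri rj !addbT.
      exact/contra/s.
    + by rewrite (s _ rj) in ri.
    + by move: xi xj; rewrite !LE ri (negPf rj) addbT addbF => /[swap] /s ->.
    + apply/orP; right; apply: sub => y; rewrite !LE.
      by rewrite (negPf ri) (negPf rj) !addbF; apply: s.
  - have [rj|rj] := boolP (r \in f j); have [ri|ri] := boolP (r \in f i).
    + by have := s r; rewrite !inE ri rj.
    + apply/orP; left; apply: sub => y; rewrite !LE rj (negPf ri) addbT addbF.
      by move=> yi; have := s y; rewrite !inE yi /= => ->.
    + apply/orP; right; apply: sub => y; rewrite !LE ri (negPf rj) addbT addbF.
      by move=> yi; have := s y; rewrite !inE yi andbT => ->.
    + have := s x; move: xi xj; rewrite !LE (negPf ri) (negPf rj) !addbF.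
      by rewrite !inE => -> ->.
  - have [rj|rj] := boolP (r \in f j); have [ri|ri] := boolP (r \in f i).
    + have := s x; move: xi xj; rewrite !LE rj ri !addbT !inE.
      by move=> /negPf-> /negPf->.
    + apply/orP; right; apply: sub => y; rewrite !LE rj (negPf ri) addbT addbF.
      by move=> /negPf yi; have := s y; rewrite !inE yi orbF.
    + apply/orP; left; apply: sub => y; rewrite !LE ri (negPf rj) addbT addbF.
      by move=> /negPf yi; have := s y; rewrite !inE yi.
    + by have := s r; rewrite !inE (negPf ri) (negPf rj).
(* The ranks only break ties between equal members. *)
pose above j i :=
  (L i \proper L j) || (L i == L j) && (enum_rank j < enum_rank i).
have aboveP j i : above j i -> L i \subset L j.
  by case/orP => [/proper_sub//|/andP[/eqP-> _]].
have above_irr : irreflexive above.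
  by move=> i; rewrite /above fintype.properxx ltnn andbF.
have above_tr : transitive above.
  move=> j i k /orP[ji|/andP[/eqP ji lji]] /orP[kj|/andP[/eqP kj lkj]];
    apply/orP.
  - by left; apply: fintype.proper_trans kj ji.
  - by left; rewrite kj.
  - by left; rewrite -ji.
  - by right; rewrite kj ji eqxx (ltn_trans lji lkj).
pose depth i := #|[set j | above j i]|.
(* Complementing a member exchanges tail and head of its tree edge. The term [r \in f i] corrects
   for this, so [col] is the parity of the depth of the tail, up to a global swap of colours. *)
pose col i := odd (depth i) (+) (r \in f i).
suff cnt b e : \sum_(i in [set i | col i == b]) leaves e (f i) <= w e.
  have := cardsID [set i | col i == true] [set: I]%SET.
  rewrite finset.setTI cardsT.
  have -> : [set: I]%SET :\: [set i | col i == true] = [set i | col i == false].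
    by apply/setP => i; rewrite !inE; case: (col i).
  have [le|le] := leqP #|I| #|[set i | col i == true]|.*2 => eqI.
    by exists [set i | col i == true].
  by exists [set i | col i == false]; [lia|].
(* The tree path from [tl e] to [hd e] first climbs out of the sets indexed by [Ic false], then
   descends into those indexed by [Ic true]; the [a] sets containing both ends lie above all of
   these. *)
pose x c := if c then hd e else tl e.
pose Ic c := [set i | (x c \in L i) && (x (~~ c) \notin L i)].
have IcE c i : (i \in Ic c) = leaves e (f i) && ((r \in f i) == c).
  rewrite inE !LE /leaves /x; have := @F_no_enter _ e (Ff i).
  case: c; case: (r \in f i); case: (tl e \in f i);
  by case: (hd e \in f i) => //= /(_ isT).
pose a := #|[set j | (tl e \in L j) && (hd e \in L j)]|.
have depthE c i : i \in Ic c -> depth i = a + #|[set j in Ic c | above j i]|.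
  rewrite inE => /andP[xi yi]; rewrite /depth /a.
  rewrite -cardsUI [X in _ = _ + X](_ : _ = 0); last first.
    apply: eq_card0 => j; rewrite !inE /x; case: c {xi yi}; 
    by case: (hd e \in L j); case: (tl e \in L j).
  rewrite addn0; apply: eq_card => j; rewrite !inE.
  have -> : (tl e \in L j) && (hd e \in L j)
      = (x c \in L j) && (x (~~ c) \in L j).
    by rewrite /x; case: (c) => //=; rewrite andbC.
  have [xj|xj] := boolP (x c \in L j); last first.
    by apply/negP => /aboveP /fintype.subsetP /(_ _ xi); apply/negP.
  have [yj|yj] := boolP (x (~~ c) \in L j) => //=.
  apply/orP; left; have := lam _ _ _ xi xj.
  case/orP => s; last by have := fintype.subsetP s _ yj; rewrite (negPf yi).
  by apply/properP; split => //; exists (x (~~ c)).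
have IcP c := @card_chain_parity _ (Ic c) above (b (+) c (+) odd a)
  above_irr above_tr.
have cntc c : #|[set i in Ic c | col i == b]|
    = if b (+) c (+) odd a then #|Ic c|./2 else uphalf #|Ic c|.
  rewrite -IcP; last first.
    move=> i j; rewrite !inE => /andP[xi _] /andP[xj _] nij.
    rewrite /above !finset.properEneq; have := lam _ _ _ xi xj.
    rewrite (eq_sym (L j)).
    case: eqVneq => [_ _|_] /=; last by rewrite orbC !orbF.
    by rewrite -neq_ltn; apply: contra nij => /eqP /ord_inj /enum_rank_inj ->.
  apply: eq_card => i; rewrite finset.in_set [in RHS]finset.in_set.
  have [ci|] //= := boolP (i \in Ic c); rewrite /col (depthE _ _ ci) oddD.
  move: ci; rewrite IcE => /andP[_ /eqP->].
  by case: b {IcP}; case: c; case: (odd a); case: (odd _).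
have splitc (P : pred I) : \sum_(i | P i) leaves e (f i)
    = #|[set i in Ic false | P i]| + #|[set i in Ic true | P i]|.
  have inP c i : (i \in [set i in Ic c | P i]) = (i \in Ic c) && P i.
    by rewrite finset.in_set.
  rewrite -cardsUI [X in _ = _ + X](_ : _ = 0); last first.
    apply: eq_card0 => i; rewrite finset.in_setI !inP !IcE.
    by case: (r \in f i); rewrite /= ?andbF.
  rewrite addn0 -sum1_card big_mkcond [in RHS]big_mkcond /=.
  apply: eq_bigr => i _.
  rewrite finset.in_setU !inP !IcE.
  by case: (P i); case: (leaves _ _); case: (r \in f i).
have := splitc predT; have := splitc (fun i => col i == b).
have -> : [set i in Ic false | predT i] = Ic false.
  by apply/setP => i; rewrite finset.in_set andbT.
have -> : [set i in Ic true | predT i] = Ic true.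
  by apply/setP => i; rewrite finset.in_set andbT.
(* The two legs of the path are halved with opposite roundings, so the sum is at most half of
   [(w e).*2], even when both legs are odd. *)
rewrite (cntc false) (cntc true) addbF addbT => sum_b sum_all.
rewrite (eq_bigl (fun i => col i == b)) => [|i]; last by rewrite finset.in_set.
rewrite sum_b; move: (cf e); rewrite sum_all {sum_b sum_all}.
by case: (b); case: (odd a) => /=; move: #|Ic _| #|Ic _| (w e) => n1 n2 k; lia.
Qed.

Definition has_packing (w : E -> nat) (k : nat) :=
  exists (I : finType) (f : I -> {set V}), packing w f /\ k <= #|I|.

Lemma has_packing_leq w w' k k' :
  (forall e, w e <= w' e) -> k' <= k -> has_packing w k -> has_packing w' k'.
Proof.
move=> le_w le_k [I [f [/andP[Ff /forallP cf] le_kI]]].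
exists I, f; split; last exact: leq_trans le_kI.
by apply/andP; split=> //; apply/forallP => e; apply: leq_trans (le_w e).
Qed.

Lemma has_packing_add w w' k k' :
  has_packing w k -> has_packing w' k' ->
  has_packing (fun e => w e + w' e) (k + k').
Proof.
move=> [I [f [/andP[/forallP Ff /forallP cf] le_kI]]].
move=> [I' [f' [/andP[/forallP Ff' /forallP cf'] le_kI']]].
exists (I + I')%type, (fun i => match i with inl i => f i | inr i => f' i end).
split; last by rewrite card_sum leq_add.
apply/andP; split; [apply/forallP | apply/forallP => e]; first by case.
by rewrite big_sumType leq_add.
Qed.

(** After uncrossing, one of the two colours has at least half of the members, and half of an odd
    number rounds up. *)
Lemma has_packing_half w k :
  has_packing (fun e => (w e).*2) k.*2.+1 -> has_packing w k.+1.
Proof.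
move=> [I [f0 [pf0 le_kI]]]; have [f pf xf] := uncross pf0.
have [S le_S cS] := cross_free_balanced pf xf.
exists 'I_#|S|, (fun i => f (enum_val i)); split; last by rewrite card_ord; lia.
case/andP: pf => /forallP Ff _; apply/andP; split; apply/forallP => // e.
by rewrite -(big_enum_val (fun i => nat_of_bool (leaves e (f i)))).
Qed.

Definition dijoin (J : {set E}) :=
  [forall U, F U ==> [exists e in J, leaves e U]].

Lemma dijoinP (J : {set E}) :
  reflect (forall U, F U -> exists2 e, e \in J & leaves e U) (dijoin J).
Proof.
apply: (iffP forallP) => dJ U; last by apply/implyP => FU; exact/exists_inP/dJ.
by move: (dJ U) => /implyP FJ FU; exact/exists_inP/FJ.
Qed.

Hypothesis F_leave : forall U, F U -> exists e, leaves e U.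

Lemma has_packing_bound w k : has_packing w k -> k <= \sum_e w e.
Proof.
move=> [I [f [/andP[/forallP Ff /forallP cf] le_kI]]]; apply: leq_trans le_kI _.
apply: leq_trans (_ : \sum_e \sum_i leaves e (f i) <= _); last exact: leq_sum.
rewrite exchange_big /= -sum1_card; apply: leq_sum => i _.
by have [e le] := F_leave (Ff i); rewrite (bigD1 e) //= le.
Qed.

(* Lovasz's proof: if no capacity can be lowered without losing a packing of the
   maximal size [k], raise the capacities of [S] from 1 to 2 one at a time; when
   size [k + 1] first becomes possible, by raising [e], adding a packing of size
   [k] that avoids [e] contradicts [has_packing_half]. *)
Theorem dijoin_packing (S : {set E}) :
  exists2 J, dijoin J & has_packing (fun e => e \in S) #|J :&: S|.
Proof.
have [n] := ubnP #|S|; elim: n S => // n IHn S leSn.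
pose has k := has_packing (fun e => e \in S) k.
have ex_has : exists k, `[< has k >].
  exists 0; apply/asboolP; exists 'I_0, (fun=> finset.set0); split => //.
  apply/andP; split; apply/forallP; first by case.
  by move=> e; rewrite big_ord0.
have bound k : `[< has k >] -> k <= \sum_e (e \in S).
  by move=> /asboolP; apply: has_packing_bound.
case: (ex_maxnP ex_has bound) => k /asboolP has_k max_k.
have no_k1 : ~ has k.+1 by move=> /asboolP/max_k; rewrite ltnn.
(* If removing the capacity of some [e] loses size [k], the dijoin found for [S :\ e] can afford the
   extra element [e]. *)
have [[e eS no_e]|all_e] := pselect (exists2 e, e \in S &
    ~ has_packing (fun x => x \in S :\ e) k).
  have [|J dJ pJ] := IHn (S :\ e).
    by move: leSn; rewrite (cardsD1 e S) eS; lia.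
  exists (e |: J).
    apply/dijoinP => U /(dijoinP _ dJ)[x xJ lx].
    by exists x => //; rewrite !inE xJ orbT.
  have ltk : #|J :&: (S :\ e)| < k.
    rewrite ltnNge; apply/negP => le_k; apply: no_e.
    exact: has_packing_leq le_k pJ.
  apply: has_packing_leq has_k => //; apply: leq_trans ltk.
  apply: leq_trans (_ : #|e |: (J :&: (S :\ e))| <= _).
    apply/subset_leq_card/fintype.subsetP => x; rewrite !inE.
    by case: eqP.
  by rewrite cardsU1; case: (_ \notin _).
have {}all_e e : e \in S -> has_packing (fun x => x \in S :\ e) k.
  by move=> eS; apply: contrapT => no_e; apply: all_e; exists e.
case: k => [|k] in has_k max_k no_k1 all_e *.
  (* A member of [F] left only by elements of [S] would be a packing of size 1. *)
  exists (~: S); last first.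
    apply: has_packing_leq has_k => //.
    by rewrite finset.setIC finset.setICr cards0.
  apply/dijoinP => U FU; apply: contrapT => no_x; apply: no_k1.
  exists unit, (fun=> U); split; last by rewrite card_unit.
  apply/andP; split; apply/forallP => // e.
  rewrite big_const card_unit /= addn0.
  case: (boolP (leaves e U)) => // le; case: (boolP (e \in S)) => // neS.
  by case: no_x; exists e; rewrite ?inE.
have no_T m (T : {set E}) : #|T| = m -> T \subset S ->
    ~ has_packing (fun e => (e \in S) + (e \in T)) k.+2.
  elim: m T => [|m IHm] T cT sTS.
    move=> p; apply: no_k1; apply: has_packing_leq p => // e.
    by rewrite (cards0_eq cT) inE addn0.
  have /card_gt0P[e eT] : 0 < #|T| by rewrite cT.
  have eS := fintype.subsetP sTS _ eT; move=> p.
  apply: (IHm (T :\ e)).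
  - by move: cT; rewrite (cardsD1 e T) eT => -[].
  - by apply: fintype.subset_trans sTS; apply: subD1set.
  (* Sizes [k.+2] and [k.+1] add up to [(k.+1).*2.+1]. Since the second packing avoids [e], the
     added capacities are at most twice those for [T :\ e]. *)
  apply: has_packing_half.
  apply: has_packing_leq (has_packing_add p (all_e _ eS)).
    move=> x; rewrite !inE; case: eqP => [->|_]; rewrite ?eS ?eT //=.
    by case: (x \in S); case: (x \in T).
  lia.
(* With capacity 2 on all of [S], a packing of size [k.+1] can be taken twice, which gives at least
   [k.+2] members. *)
case: (no_T _ S erefl) => //.
by apply: has_packing_leq (has_packing_add has_k has_k) => //; lia.
Qed.

End CrossingFamily.

(** * Reversing a minimal dijoin *)

Section ReverseDijoin.

Variables (V E : finType) (tl hd : E -> V) (cl : pred {set V}).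
Hypothesis clI : forall U W, cl U -> cl W -> cl (U :&: W).
Hypothesis clU : forall U W, cl U -> cl W -> cl (U :|: W).

(** [cl] stands for the sets that no arc of [A] enters: arcs restrict which sets are dicuts, while
    only elements of [E] can be in a dijoin. *)
Definition dicut (U : {set V}) :=
  [&& U != finset.set0, U != [set: V]%SET, cl U
    & [forall e, (hd e \in U) ==> (tl e \in U)]].

Lemma dicut_no_enter U e : dicut U -> hd e \in U -> tl e \in U.
Proof. by case/and4P => _ _ _ /forallP/(_ e)/implyP. Qed.

Lemma dicut_crossing U W : dicut U -> dicut W ->
  U :&: W != finset.set0 -> U :|: W != [set: V]%SET ->
  dicut (U :&: W) && dicut (U :|: W).
Proof.
move=> dU dW nI nU; have := dicut_no_enter dU; have := dicut_no_enter dW.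
case/and4P: (dU) => U0 UT cU _; case/and4P: (dW) => W0 WT cW _ eW eU.
apply/andP; split; apply/and4P; split=> //.
- apply: contraNneq UT => IT; rewrite -finset.subTset -IT.
  exact: finset.subsetIl.
- exact: clI.
- apply/forallP => e; rewrite !inE; apply/implyP => /andP[hU hW].
  by rewrite eU // eW.
- apply: contraNneq U0 => IT; rewrite -finset.subset0 -IT.
  exact: finset.subsetUl.
- exact: clU.
- apply/forallP => e; rewrite !inE; apply/implyP => /orP[hU|hW].
    by rewrite eU.
  by rewrite eW // orbT.
Qed.

(* Together with the last hypothesis, the conclusion says that reversing
   [J] leaves no [U] without an entering arc. If [U] is a counterexample and
   [j] in [J] enters [U], minimality gives a dicut [W] that only [j] covers;
   then [U :&: W] or [U :|: W] is a counterexample entered by fewer elements of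
   [J], unless [W] is the complement of [U], and then [j] alone leaves [W]. *)
Lemma minimal_dijoin_reverse (J : {set E}) (U : {set V}) :
    minset (dijoin tl hd dicut) J ->
    (forall W, dicut W -> 1 < #|[set e | leaves tl hd e W]|) ->
    U != finset.set0 -> U != [set: V]%SET -> cl U ->
    (forall e, e \notin J -> hd e \in U -> tl e \in U) ->
  exists2 e, e \in J & leaves tl hd e U.
Proof.
move=> /minsetP[/dijoinP dJ minJ] big_cut.
pose enter (W : {set V}) := [set e in J | (hd e \in W) && (tl e \notin W)].
have [n] := ubnP #|enter U|; elim: n U => // n IHn U leUn U0 UT cU eU.
apply: contrapT => no_e.
have jU e : e \in J -> tl e \in U -> hd e \in U.
  move=> eJ tU; apply/negPn/negP => hU; apply: no_e.
  by exists e; rewrite // /leaves tU.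
have [j [jJ hj tj]] : exists j, [/\ j \in J, hd j \in U & tl j \notin U].
  apply: contrapT => no_j; apply: no_e; apply: dJ.
  apply/and4P; split=> //; apply/forallP => e; apply/implyP => he.
  have [eJ|/eU-> //] := boolP (e \in J).
  by apply/negPn/negP => te; apply: no_j; exists e.
have [W dW Wj] : exists2 W, dicut W &
    forall e, e \in J -> leaves tl hd e W -> e = j.
  apply: contrapT => no_W.
  have : J :\ j = J; last first.
    by move/setP/(_ j); rewrite !inE eqxx jJ.
  apply: minJ; last exact: finset.subD1set.
  apply/dijoinP => W dW; apply: contrapT => no_x; apply: no_W.
  exists W => // e eJ le; apply: contrapT => /eqP ne.
  by apply: no_x; exists e; rewrite // !inE ne.
have /andP[tjW hjW] : leaves tl hd j W.
  by have [e eJ le] := dJ _ dW; rewrite -(Wj e).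
case/and4P: (dW) => W0 WT cW _; have eW e := @dicut_no_enter W e dW.
have jW e : e \in J -> tl e \in W -> e != j -> hd e \in W.
  move=> eJ tW; apply: contraNT => hW; apply/eqP/Wj => //.
  by rewrite /leaves tW.
have no_leave (X : {set V}) : ~ (exists2 e, e \in J & leaves tl hd e X) <->
    (forall e, e \in J -> tl e \in X -> hd e \in X).
  split=> [no e eJ tX|hX [e eJ /andP[/(hX _ eJ)->]] //].
  by apply/negPn/negP => hX; apply: no; exists e; rewrite // /leaves tX.
have [I0|I0] := eqVneq (U :&: W) finset.set0; last first.
  suff : ~ (exists2 e, e \in J & leaves tl hd e (U :&: W)).
    apply; apply: IHn => //.
    - apply: leq_trans _ (_ : #|enter U| <= n); last by rewrite -ltnS.
      apply/proper_card/properP; split.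
        apply/fintype.subsetP => e; rewrite !inE.
        case/andP=> -> /andP[/andP[-> hW]].
        by rewrite eW // andbT.
      by exists j; rewrite !inE jJ ?hj ?tj //= (negPf hjW).
    - apply: contraNneq WT => IT; rewrite -finset.subTset -IT.
      exact: finset.subsetIr.
    - exact: clI.
    by move=> e eJ; rewrite !inE => /andP[hU hW]; rewrite eU // eW.
  apply/no_leave => e eJ; rewrite !inE => /andP[tU tW].
  by rewrite jU // jW //; apply: contraNneq tj => <-.
have [U1|U1] := eqVneq (U :|: W) [set: V]%SET; last first.
  suff : ~ (exists2 e, e \in J & leaves tl hd e (U :|: W)).
    apply; apply: IHn => //.
    - apply: leq_trans _ (_ : #|enter U| <= n); last by rewrite -ltnS.
      apply/proper_card/properP; split.
        apply/fintype.subsetP => e; rewrite !inE negb_or.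
        case/andP=> -> /andP[/orP[->|hW]] /andP[-> //].
        by rewrite eW.
      by exists j; rewrite !inE jJ ?hj ?tj //= tjW orbT.
    - apply: contraNneq U0 => IT; rewrite -finset.subset0 -IT.
      exact: finset.subsetUl.
    - exact: clU.
    move=> e eJ; rewrite !inE => /orP[hU|hW]; first by rewrite eU.
    by rewrite eW // orbT.
  apply/no_leave => e eJ; rewrite !inE => /orP[tU|tW]; first by rewrite jU.
  by have [->|ne] := eqVneq e j; rewrite ?hj // jW // orbT.
have := big_cut _ dW; apply/negP; rewrite -leqNgt -(cards1 j).
apply/subset_leq_card/fintype.subsetP => e; rewrite !inE => /andP[tW hW].
have hU : hd e \in U by move/setP/(_ (hd e)): U1; rewrite !inE (negPf hW) orbF.
have tU : tl e \notin U.
  by apply/negP => tU; move/setP/(_ (tl e)): I0; rewrite !inE tU tW.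
have eJ : e \in J by apply: contraNT tU => /eU ->.
by apply/eqP/Wj; rewrite // /leaves tW.
Qed.

End ReverseDijoin.

(** * Strong orientations near a given orientation *)

Lemma cut_strong_orientation (G : mixed_graph) (o : orientation G) :
    (forall U : {set mg_vertex G},
       U != finset.set0 -> U != [set: mg_vertex G]%SET ->
       arcs_in U == finset.set0 ->
       exists2 e, edge_tail o e \notin U & edge_head o e \in U) ->
  strong_orientation o.
Proof.
move=> cut_o; apply/forallP => u; apply/forallP => v; apply/negPn/negP => nuv.
(* If [v] is unreachable from [u], nothing enters the set of vertices unreachable from [u]. *)
pose U := [set x | ~~ connect (oriented_adj o) u x]%SET.
have UE x : (x \in U) = ~~ connect (oriented_adj o) u x by rewrite inE.
have step x y : oriented_adj o x y -> x \notin U -> y \notin U.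
  move=> xy; rewrite !UE !negbK => ux; exact: connect_trans ux (connect1 xy).
have [|||e te he] := cut_o U.
- by apply/set0Pn; exists v; rewrite UE.
- by apply/eqP => /setP/(_ u); rewrite UE inE connect0.
- apply/eqP/setP => a; rewrite !inE; apply/andP => -[ta ha].
  have : arc_head a \notin U; last by rewrite UE negbK => c; rewrite c in ha.
  apply: step (arc_tail a) _ _ _; last by rewrite UE.
  by apply/orP; left; apply/existsP; exists a; rewrite !eqxx.
- move: he; apply/negP; apply: step te.
  by apply/orP; right; apply/existsP; exists e; rewrite !eqxx.
Qed.

Local Open Scope ring_scope.

Lemma strong_orientation_near (R : realType) (G : mixed_graph) (lambda : R)
    (lambda_gt1 : 1 < lambda)
    (dicut_ge : forall C : {set mg_arc G + mg_edge G},
        pseudo_dicut C -> lambda <= #|cut_edges C|%:R) (o : orientation G) :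
  exists2 s : orientation G, strong_orientation s
    & lambda * #|[set e | s e != o e]%SET|%:R <= #|mg_edge G|%:R.
Proof.
pose tl := edge_tail o; pose hd := edge_head o.
pose cl (U : {set mg_vertex G}) := arcs_in U == finset.set0.
have clP (U : {set mg_vertex G}) :
    reflect (forall a, arc_head a \in U -> arc_tail a \in U) (cl U).
  apply: (iffP eqP) => [/setP U0 a ha|U0].
    by have := U0 a; rewrite !inE ha andbT => /negbFE.
  by apply/setP => a; rewrite !inE; apply/andP => -[/negP ta /U0].
have clI U W : cl U -> cl W -> cl (U :&: W)%SET.
  move=> /clP cU /clP cW; apply/clP => a; rewrite !inE => /andP[aU aW].
  by rewrite cU // cW.
have clU U W : cl U -> cl W -> cl (U :|: W)%SET.
  move=> /clP cU /clP cW; apply/clP => a; rewrite !inE => /orP[aU|aW].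
    by rewrite cU.
  by rewrite cW // orbT.
have leave_ge U : dicut tl hd cl U ->
    lambda <= #|[set e | leaves tl hd e U]%SET|%:R.
  move=> dU; case/and4P: (dU) => U0 UT /eqP cU _.
  have := dicut_ge (mg_cut U).
  rewrite (_ : cut_edges _ = [set e | leaves tl hd e U]%SET).
    by apply; exists U; split=> //; rewrite finset.properEneq UT finset.subsetT.
  apply/setP => e; rewrite !inE /leaves.
  have := @dicut_no_enter _ _ _ _ _ _ e dU.
  rewrite /tl /hd /edge_tail /edge_head.
  by case: (o e); case: (_ \in U); case: (_ \in U) => // /(_ isT).
have leave_gt1 U : dicut tl hd cl U ->
    (1 < #|[set e | leaves tl hd e U]%SET|)%N.
  by move=> /leave_ge; rewrite -(ltr_nat R); apply: lt_le_trans.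
(* Capacity 1 on every edge makes the packed dicuts edge-disjoint; there are at least [#|J0|] of
   them. *)
have [||U dU|J0 dJ0 [I [f [/andP[/forallP Ff /forallP cf] leJI]]]] :=
    @dijoin_packing _ _ tl hd (dicut tl hd cl) _ _ _ [set: mg_edge G]%SET.
- by move=> U e; apply: dicut_no_enter.
- exact: dicut_crossing.
- have /ltnW/card_gt0P[e] := leave_gt1 _ dU; by rewrite inE; exists e.
have [J minJ sJ] := minset_exists dJ0.
pose s : orientation G := [ffun e => o e (+) (e \in J)].
exists s.
  apply: cut_strong_orientation => U U0 UT cU.
  have tlE e : edge_tail s e = if e \in J then hd e else tl e.
    rewrite /tl /hd /edge_tail /edge_head ffunE.
    by case: (o e); case: (e \in J).
  have hdE e : edge_head s e = if e \in J then tl e else hd e.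
    rewrite /tl /hd /edge_tail /edge_head ffunE.
    by case: (o e); case: (e \in J).
  apply: contrapT => no_e.
  have [//|e eJ /andP[te he]] :=
    minimal_dijoin_reverse clI clU minJ leave_gt1 U0 UT cU.
    (* An edge outside [J] keeps its direction, so if it entered [U] under [o] it would do so under
       [s]; an edge of [J] leaving [U] under [o] enters it under [s]. *)
    move=> e eJ he; apply/negPn/negP => te.
    by apply: no_e; exists e; rewrite ?tlE ?hdE (negPf eJ).
  by apply: no_e; exists e; rewrite ?tlE ?hdE eJ.
have -> : [set e | s e != o e]%SET = J.
  by apply/setP => e; rewrite inE ffunE; case: (o e); case: (e \in J).
have leJ : (#|J| <= #|I|)%N.
  by apply: leq_trans leJI; rewrite finset.setIT subset_leq_card.
have le_sum : (\sum_i #|[set e | leaves tl hd e (f i)]%SET| <= #|mg_edge G|)%N.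
  under eq_bigr do rewrite -sum1_card big_mkcond.
  rewrite exchange_big /= -sum1_card; apply: leq_sum => e _.
  apply: leq_trans (_ : _ <= (e \in [set: mg_edge G]%SET))%N _;
    last by case: (e \in _).
  apply: leq_trans (cf e); apply: leq_sum => i _; rewrite inE.
  by case: (leaves _ _ _ _).
apply: le_trans (_ : lambda * #|I|%:R <= _).
  by rewrite ler_pM2l ?ler_nat // (lt_trans _ lambda_gt1).
apply: le_trans (_ : (\sum_i #|[set e | leaves tl hd e (f i)]%SET|)%N%:R <= _);
  last by rewrite ler_nat.
rewrite natr_sum mulr_natr -sumr_const; apply: ler_sum => i _; exact: leave_ge.
Qed.

(** * Entropy bound on Hamming balls and the final count *)

Lemma powR2E (R : realType) (x : R) : 2 `^ x = expR (x * ln 2).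
Proof. by rewrite /powR pnatr_eq0. Qed.

(** Under independent flips of probability [eps], the weight of a point does not increase with its
    distance from [s], as [eps <= 1 - eps]. At distance [eps * #|T|] the formula gives the inverse
    of the right-hand side, so every point of the ball weighs at least that, while the total weight
    is 1. *)
Lemma card_hamming_ball (R : realType) (T : finType) (eps : R)
    (s : {ffun T -> bool}) :
    0 < eps -> eps <= 2^-1 ->
  #|[set o : {ffun T -> bool} |
      #|[set e | s e != o e]%SET|%:R <= eps * #|T|%:R]%SET|%:R
    <= 2 `^ (binary_entropy eps * #|T|%:R).
Proof.
move=> eps_gt0 eps_le; set B := [set o | _]%SET.
have eps1 : 0 < 1 - eps by lra.
(* The distribution of [s] with each bit flipped with probability [eps]. *)
pose p (o : {ffun T -> bool}) := \prod_e (if s e == o e then 1 - eps else eps).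
have p_ge0 o : 0 <= p o by apply: prodr_ge0 => e _; case: ifP => _; lra.
have sum_p : \sum_o p o = 1.
  rewrite -(bigA_distr_bigA (fun e b => if s e == b then 1 - eps else eps)) /=.
  rewrite big1 // => e _; rewrite big_bool /=; case: (s e) => /=; lra.
have ln2 : ln 2 != 0 :> R by rewrite gt_eqF // ln_gt0 // ltr1n.
have p_ge o : o \in B -> (2 `^ (binary_entropy eps * #|T|%:R))^-1 <= p o.
  rewrite inE => oB; rewrite powR2E -expRN.
  have -> : p o = expR (\sum_e (if s e == o e then ln (1 - eps) else ln eps)).
    rewrite expR_sum; apply: eq_bigr => e _.
    by case: ifP => _; rewrite lnK // posrE.
  rewrite ler_expR.
  have -> : \sum_e (if s e == o e then ln (1 - eps) else ln eps)
      = #|T|%:R * ln (1 - eps)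
        + #|[set e | s e != o e]%SET|%:R * (ln eps - ln (1 - eps)).
    rewrite mulr_natl mulr_natl -!sumr_const [X in _ = _ + X]big_mkcond /=.
    rewrite -big_split /=; apply: eq_bigr => e _; rewrite inE.
    by case: (s e == o e) => /=; ring.
  have le_ln : ln eps <= ln (1 - eps) by rewrite ler_ln ?posrE //; lra.
  have -> : - (binary_entropy eps * #|T|%:R * ln 2)
      = #|T|%:R * ln (1 - eps) + eps * #|T|%:R * (ln eps - ln (1 - eps)).
    by rewrite /binary_entropy /log2; field.
  by rewrite lerD2l ler_wnM2r // subr_le0.
have pos : 0 < 2 `^ (binary_entropy eps * #|T|%:R) by rewrite powR_gt0.
rewrite -[leRHS]mul1r -ler_pdivrMr // -[leRHS]sum_p.
apply: le_trans (_ : \sum_(o in B) p o <= _).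
  by rewrite mulr_natl -sumr_const; apply: ler_sum.
by rewrite [leRHS](bigID (mem B)) /= lerDl sumr_ge0.
Qed.

Theorem theorem1p8 (R : realType) (G : mixed_graph) (lambda : R)
    (lambda_ge3 : 3 <= lambda)
    (dicut_ge : forall C : {set mg_arc G + mg_edge G},
        pseudo_dicut C -> lambda <= #|cut_edges C|%:R) :
  2 `^ ((1 - binary_entropy lambda^-1) * #|mg_edge G|%:R)
    <= #|[set o : orientation G | strong_orientation o]|%:R.
Proof.
have lambda_gt0 : 0 < lambda by lra.
pose ball (s : orientation G) := [set o : orientation G |
  #|[set e | s e != o e]%SET|%:R <= lambda^-1 * #|mg_edge G|%:R]%SET.
have cover : (2 ^ #|mg_edge G| <= \sum_(s | strong_orientation s) #|ball s|)%N.
  rewrite -card_bool -card_ffun -sum1_card.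
  rewrite [leqRHS](eq_bigr (fun s => \sum_o (o \in ball s)))%N; last first.
    by move=> s _; rewrite -sum1_card big_mkcond.
  rewrite exchange_big /=; apply: leq_sum => o _.
  have [|s ss ds] := strong_orientation_near _ dicut_ge o; first lra.
  rewrite (bigD1 s) //= [X in (nat_of_bool X + _)%N]inE.
  by rewrite ler_pdivlMl // ds.
(* [3 <= lambda] gives [lambda^-1 <= 2^-1], as the ball bound requires. *)
have ball_le s :
    #|ball s|%:R <= 2 `^ (binary_entropy lambda^-1 * #|mg_edge G|%:R) :> R.
  apply: card_hamming_ball; rewrite ?invr_gt0 // lef_pV2 ?posrE //; lra.
rewrite mulrBl mul1r powRB ?pnatr_eq0 ?implybT // powR_mulrn //.
rewrite ler_pdivrMr ?powR_gt0 // -natrX.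
apply: le_trans (_ : (\sum_(s | strong_orientation s) #|ball s|)%N%:R <= _).
  by rewrite ler_nat.
rewrite natr_sum mulr_natl -sumr_const.
rewrite [leRHS](eq_bigl (@strong_orientation G)) => [|o]; last by rewrite inE.
exact: ler_sum.
Qed.
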